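(* Let $D$ be a finite oriented graph and let $\ell$ be largest such that $D$ contains (as a subgraph) an orientation of $K_\ell$. Then, asymptotically almost surely, a uniformly random labelled $D$-coloured digraph is such that the image of its colouring homomorphism to $D$ is contained in a subgraph of $D$ which is an orientation of a blow-up of $K_\ell$.
   Context: An oriented graph is an irreflexive digraph with antisymmetric edge relation. A $D$-coloured digraph is a digraph $G$ with unary predicates $P_u$, $u\in V(D)$, such that each vertex lies in exactly one $P_u$ and the map $x\mapsto u$ for $x\in P_u$ is a homomorphism $G\to D$ (the colouring homomorphism). Labelled means vertex set $\{1,\dots,n\}$; a property holds asymptotically almost surely if the fraction of labelled $D$-coloured digraphs on $\{1,\dots,n\}$ having it tends to $1$ as $n\to\infty$. A blow-up of $K_\ell$ is obtained by replacing each vertex by a non-empty set of copies with the same neighbours and no edges among copies of the same vertex; an orientation of an undirected graph chooses exactly one direction for each edge. *)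

(* Defs.v *)
From mathcomp Require Import all_boot all_order all_algebra.
From mathcomp Require Import boolp.
Set Implicit Arguments. Unset Strict Implicit. Unset Printing Implicit Defensive.
Import Order.TTheory GRing.Theory Num.Theory.

Definition oriented (V : finType) (E : rel V) : Prop :=
  (forall u, ~~ E u u) /\ (forall u v, E u v -> ~~ E v u).

Definition is_subgraph (V : finType) (E : rel V) (W : {set V}) (F : rel V) : Prop :=
  forall u v, F u v -> [/\ u \in W, v \in W & E u v].

Definition is_orientation_of (V : finType) (W : {set V}) (F U : rel V) : Prop :=
  forall u v, u \in W -> v \in W ->
    (U u v = F u v || F v u) /\ ~~ (F u v && F v u).

Definition iso_complete (V : finType) (l : nat) (W : {set V}) (U : rel V) : Prop :=
  exists f : 'I_l -> V, [/\ injective f, f @: setT = W &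
    forall i j, U (f i) (f j) = (i != j)].

(* the undirected graph (W, U) is (isomorphic to) a blow-up of K_l:
   vertex u of W is a copy of vertex p u of K_l; every vertex of K_l
   has a non-empty set of copies *)
Definition is_blowup_complete (V : finType) (l : nat) (W : {set V}) (U : rel V) : Prop :=
  exists p : V -> 'I_l, p @: W = setT /\
    forall u v, u \in W -> v \in W -> U u v = (p u != p v).

Definition contains_oriented_complete (V : finType) (E : rel V) (l : nat) : Prop :=
  exists (W : {set V}) (F U : rel V),
    [/\ is_subgraph E W F, is_orientation_of W F U & iso_complete l W U].

Definition oriented_blowup_subgraph (V : finType) (E : rel V) (l : nat)
    (W : {set V}) (F : rel V) : Prop :=
  is_subgraph E W F /\
  exists U : rel V, is_orientation_of W F U /\ is_blowup_complete l W U.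

(* Labelled D-coloured digraph on {1..n} (encoded as 'I_n): a digraph
   G (arc set, irreflexive) with a colouring c (x lies in P_(c x)) which
   is a homomorphism G -> D. *)
Definition is_Dcoloured (V : finType) (E : rel V) (n : nat)
    (c : {ffun 'I_n -> V}) (G : {set 'I_n * 'I_n}) : bool :=
  [forall x, (x, x) \notin G] &&
  [forall x, forall y, ((x, y) \in G) ==> E (c x) (c y)].

Definition Dcoloured_set (V : finType) (E : rel V) (n : nat)
  : {set {ffun 'I_n -> V} * {set 'I_n * 'I_n}} :=
  [set cg | is_Dcoloured E cg.1 cg.2].

Definition image_contained_in (V : finType) (n : nat)
    (c : {ffun 'I_n -> V}) (G : {set 'I_n * 'I_n}) (W : {set V}) (F : rel V) : Prop :=
  (forall x, c x \in W) /\ (forall x y, (x, y) \in G -> F (c x) (c y)).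

Definition aas (V : finType) (E : rel V)
    (P : forall n, {ffun 'I_n -> V} -> {set 'I_n * 'I_n} -> Prop) : Prop :=
  forall eps : rat, (0 < eps)%R -> exists N : nat, forall n : nat, (N <= n)%N ->
    (`| 1 - (#|[set cg in Dcoloured_set E n | `[< P n cg.1 cg.2 >] ]|%:R
            / #|Dcoloured_set E n|%:R) | < eps)%R.

(* Main.v *)
(* The colouring [c] carries [2 ^ energy c] digraphs, where [energy c] is the
   number of edges of the pull-back of [E] along [c].  Let [k = #|V|] and let [r]
   be about [sqrt n].  Three kinds of colourings have negligible total weight,
   each by comparison with heavier or more numerous colourings:
   - those with energy more than [(k + 1) n] below the maximum;
   - those where recolouring one vertex increases the energy by at least [r];
   - those which, after changing [O(r)] vertices, avoid a colour [v] that can then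
     replace freely a colour [u] used linearly often: there are [2 ^ Omega(n)]
     such replacements, against only [n ^ O(r)] original colourings.
   For every other colouring choose a scale [theta] of order [r] such that no
   colour class has size between [theta] and [(k + 1) theta], and let [B] be the
   set of colours with large classes.  As in the Motzkin-Straus theorem, near
   maximality makes [E] complete [l]-partite on [B], with all parts of linear
   weight.  A used colour outside [B] either misses a large colour in an
   additional part, which contradicts the second point, or has the same neighbours
   in [B] as one of the parts, which contradicts the third.  So all used colours
   lie in [B]. *)
Require Import Defs.
From mathcomp Require Import all_boot all_order all_algebra.
From mathcomp Require Import boolp.
From mathcomp Require Import zify ring.
Set Implicit Arguments. Unset Strict Implicit. Unset Printing Implicit Defensive.
Import Order.TTheory GRing.Theory Num.Theory.
Local Open Scope ring_scope.

(** * The quadratic form of a graph *)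

Section QuadraticForm.
Variables (V : finType) (h : rel V).
Hypothesis h_sym : symmetric h.
Hypothesis h_irr : irreflexive h.
Implicit Types (x y z : V -> int) (u v w : V).

Definition bil x y : int := \sum_u x u * \sum_v (h u v)%:R * y v.
Definition deg x u : int := \sum_v (h u v)%:R * x v.
Definition dlt u : V -> int := fun v => (v == u)%:R.

Lemma bil_deg x y : bil x y = \sum_u x u * deg y u.
Proof. by []. Qed.

Lemma bilC x y : bil x y = bil y x.
Proof.
rewrite /bil; under eq_bigr do rewrite mulr_sumr.
rewrite exchange_big; apply: eq_bigr => u _; rewrite mulr_sumr.
by apply: eq_bigr => v _; rewrite h_sym mulrA mulrC [x v * _]mulrC.
Qed.

Lemma bil_comb a x y z : bil (fun w => a * x w + y w) z = a * bil x z + bil y z.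
Proof.
rewrite /bil mulr_sumr -big_split; apply: eq_bigr => u _ /=.
by rewrite mulrDl mulrA.
Qed.

Lemma bil_combr a x y z : bil z (fun w => a * x w + y w) = a * bil z x + bil z y.
Proof. by rewrite bilC bil_comb ![bil _ z]bilC. Qed.

Lemma sum_dltM u (f : V -> int) : \sum_v dlt u v * f v = f u.
Proof.
rewrite (bigD1 u) //= {1}/dlt eqxx mul1r [X in _ + X]big1 ?addr0 // => v.
by rewrite /dlt => /negbTE ->; rewrite mul0r.
Qed.

Lemma bil_dlt u x : bil (dlt u) x = deg x u.
Proof. by rewrite bil_deg sum_dltM. Qed.

Lemma deg_dlt u v : deg (dlt u) v = (h u v)%:R.
Proof.
by rewrite /deg h_sym -[RHS](sum_dltM u (fun w => (h v w)%:R));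
  apply: eq_bigr => w _; rewrite mulrC.
Qed.

Lemma eq_bil x x' y y' : x =1 x' -> y =1 y' -> bil x y = bil x' y'.
Proof.
move=> ex ey; apply: eq_bigr => u _; rewrite ex; congr (_ * _).
by apply: eq_bigr => v _; rewrite ey.
Qed.

(** Mass [t] moves from [v] to [u]. The nested form [a * x w + y w] lets [bil_comb] and [bil_combr]
    expand it. *)
Definition shift x (t : int) u v : V -> int :=
  fun w => t * dlt u w + ((- t) * dlt v w + x w).

Lemma bil_shift x t u v :
  bil (shift x t u v) (shift x t u v) =
  bil x x + 2 * t * (deg x u - deg x v) - 2 * t ^+ 2 * (h u v)%:R.
Proof.
rewrite !(bil_comb, bil_combr) ![bil x (dlt _)]bilC !bil_dlt !deg_dlt !h_irr.
by rewrite (h_sym v u) mulr0n; ring.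
Qed.

Lemma sum_dlt u : \sum_v dlt u v = 1.
Proof. by rewrite -[RHS](sum_dltM u (fun=> 1)); apply: eq_bigr => v _; rewrite mulr1. Qed.

Lemma sum_shift x t u v : \sum_w shift x t u v w = \sum_w x w.
Proof. by rewrite !big_split /= -!mulr_sumr !sum_dlt; ring. Qed.

Lemma shift_ge0 x t u v w : (forall w, 0 <= x w) -> 0 <= t -> t <= x v ->
  0 <= shift x t u v w.
Proof.
move=> x0 t0 tv; have := x0 w; rewrite /shift /dlt.
by case: eqP => [->|_]; case: eqP => [->|_] /=; lia.
Qed.

(* The slack is [2 * d] because [bil x x] counts every edge twice. *)
Definition near_max x (d : int) := forall y, (forall v, 0 <= y v) ->
  \sum_v y v = \sum_v x v -> bil y y <= bil x x + 2 * d.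

Lemma near_max_no_cherry x d t u v w : (forall w, 0 <= x w) -> near_max x d ->
  0 <= t -> t <= x u -> 2 * t <= x v -> t <= x w ->
  ~~ h u v -> ~~ h v w -> h u w -> t ^+ 2 <= 3 * d.
Proof.
(* Moving mass [t] from [u] or from [w] to [v] shows that the degree of [v] exceeds
   neither of theirs by more than [d / t]; moving mass [t] from [v] to each of [u]
   and [w] gains the edges between the two moved masses. *)
move=> x0 nm t0 tu tv tw /negbTE nuv /negbTE nvw uw.
have step a : ~~ h v a -> t <= x a -> t * (deg x v - deg x a) <= d.
  move=> /negbTE nva ta; have := nm (shift x t v a).
  rewrite sum_shift bil_shift nva => /(_ (fun w => shift_ge0 _ w x0 t0 ta) erefl).
  lia.
have d1 := step u; have d2 := step w; rewrite h_sym nuv in d1; rewrite nvw in d2.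
have := nm (shift (shift x t u v) t w v); rewrite !sum_shift.
have nvu : v == u = false by apply/eqP => e; move: uw; rewrite -e nvw.
have nwv : v == w = false by apply/eqP => e; move: uw; rewrite -e nuv.
have x1 b : 0 <= shift (shift x t u v) t w v b.
  have := x0 b; rewrite /shift /dlt; have [->|_] := eqVneq b v.
    by rewrite nvu nwv; lia.
  by case: eqP => _; case: eqP => _; lia.
move=> /(_ x1 erefl); rewrite !bil_shift (h_sym w v) nvw nuv /=.
have E a : deg (shift x t u v) a = t * (h u a)%:R - t * (h v a)%:R + deg x a.
  by rewrite -!bil_dlt bilC !bil_comb ![bil _ (dlt a)]bilC !bil_dlt !deg_dlt; ring.
rewrite !E uw nvw nuv h_irr /=.
have := d1 isT tu; have := d2 isT tw; rewrite ?mulr0n; lia.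
Qed.

(** * Cliques, complete multipartite sets and stability *)

Definition clique (Q : {set V}) :=
  [forall u in Q, forall v in Q, (u != v) ==> h u v].

Lemma cliqueP (Q : {set V}) :
  reflect {in Q &, forall u v, u != v -> h u v} (clique Q).
Proof.
apply: (iffP forall_inP) => [cQ u v uQ vQ uv|cQ u uQ].
  by move/forall_inP: (cQ u uQ) => /(_ v vQ); rewrite uv.
by apply/forall_inP => v vQ; apply/implyP; apply: cQ.
Qed.

Lemma clique_add (Q : {set V}) v : clique Q -> {in Q, forall q, h v q} ->
  clique (v |: Q).
Proof.
move=> /cliqueP cQ vQ; apply/cliqueP => a b.
rewrite !inE => /predU1P[->|aQ] /predU1P[->|bQ]; rewrite ?eqxx //.
- by move=> _; apply: vQ.
- by move=> _; rewrite h_sym; apply: vQ.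
- exact: cQ.
Qed.

(** Take a maximal clique inside [B]. If [B] is cherry-free, each vertex of [B] misses exactly one
    element of [Q], so [Q] is a transversal of the parts. *)
Lemma clique_covering (B : {set V}) : exists Q : {set V},
  [/\ Q \subset B, clique Q & {in B, forall u, exists2 q, q \in Q & ~~ h q u}].
Proof.
have P0 : (set0 \subset B) && clique set0.
  by rewrite sub0set; apply/cliqueP => u v; rewrite inE.
have [Q /maxsetP[/andP[QB cQ] Qmax] _] :=
  maxset_exists (P := fun Q : {set V} => (Q \subset B) && clique Q) P0.
exists Q; split=> // u uB; apply/exists_inP; apply: contraT => /exists_inPn uQ.
have /setP/(_ u) : u |: Q = Q.
  apply: Qmax; last exact: subsetUr.
  rewrite subUset sub1set uB QB clique_add // => q qQ.
  by rewrite h_sym; have := uQ q qQ; rewrite negbK.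
by rewrite !inE eqxx => /esym/uQ; rewrite h_irr.
Qed.

(* Equivalently, [h] restricted to [B] is complete multipartite. *)
Definition cherry_free (B : {set V}) := forall u v w,
  u \in B -> v \in B -> w \in B -> ~~ h u v -> ~~ h v w -> ~~ h u w.

Definition twin (B : {set V}) u v := [forall w in B, h u w == h v w].

Definition part (B : {set V}) q := [set u in B | ~~ h q u].

Definition mass x (A : {set V}) := \sum_(u in A) x u.

Lemma twin_in (B : {set V}) u v : twin B u v -> {in B, h u =1 h v}.
Proof. by move=> /forall_inP tw w wB; apply/eqP/tw. Qed.

Lemma cherry_free_twin (B : {set V}) u v : cherry_free B -> u \in B -> v \in B ->
  ~~ h u v -> twin B u v.
Proof.
move=> cf uB vB nuv; apply/forall_inP => w wB; apply/eqP; apply/idP/idP.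
  apply: contraLR => nvw; exact: cf nuv nvw.
by apply: contraLR; apply: cf => //; rewrite h_sym.
Qed.

Lemma missed_uniq (B Q : {set V}) u q q' : cherry_free B -> Q \subset B ->
  clique Q -> u \in B -> q \in Q -> q' \in Q -> ~~ h q u -> ~~ h q' u -> q = q'.
Proof.
move=> cf /subsetP QB /cliqueP cQ uB qQ q'Q nqu nq'u; apply: contraTeq isT => neq.
have := cf _ _ _ (QB q qQ) uB (QB q' q'Q) nqu.
by rewrite h_sym nq'u (cQ q q') // => /(_ isT).
Qed.

Lemma sum_mass_part (B Q : {set V}) x : cherry_free B -> Q \subset B ->
  clique Q -> {in B, forall u, exists2 q, q \in Q & ~~ h q u} ->
  \sum_(q in Q) mass x (part B q) = mass x B.
Proof.
move=> cf QB cQ cov; rewrite /mass.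
under eq_bigr do under eq_bigl do rewrite inE.
under eq_bigr do rewrite big_mkcondr; rewrite exchange_big /=.
apply: eq_bigr => u uB; have [q qQ nqu] := cov u uB.
rewrite (bigD1 q) //= nqu big1 ?addr0 // => q' /andP[q'Q]; case: ifP => // nq'u.
by rewrite (missed_uniq cf QB cQ uB q'Q qQ nq'u nqu) eqxx.
Qed.

Lemma mass_le x (A : {set V}) (c : int) : 0 <= c ->
  {in A, forall u, x u <= c} -> mass x A <= #|V|%:R * c.
Proof.
move=> c0 xc; apply: le_trans (_ : \sum_(u in A) c <= _); first exact: ler_sum.
by rewrite sumr_const -[_ *+ _]mulr_natl ler_wpM2r // ler_nat max_card.
Qed.

Lemma mass_setC x (B : {set V}) : \sum_v x v = mass x B + mass x (~: B).
Proof.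
by rewrite (bigID (mem B)) /=; congr (_ + _); apply: eq_bigl => u; rewrite inE.
Qed.

Lemma deg_le_mass x u (A : {set V}) : (forall v, 0 <= x v) ->
  {in A, forall v, ~~ h u v} -> deg x u <= \sum_v x v - mass x A.
Proof.
move=> x0 nA; rewrite (mass_setC x A) addrC addKr /deg /mass big_mkcond.
rewrite [X in _ <= X]big_mkcond; apply: ler_sum => v _ /=; rewrite inE.
have [vA|_] := boolP (v \in A); first by rewrite (negbTE (nA v vA)) mul0r.
by have := x0 v; case: (h u v) => /=; lia.
Qed.

(** A vertex of [B] sees no mass in its own part. Each vertex outside [B] carries mass at most [c]
    and has degree at most the total mass, which gives the error term. *)
Lemma bil_le_parts (B Q : {set V}) x (c : int) : cherry_free B -> Q \subset B ->
  clique Q -> {in B, forall u, exists2 q, q \in Q & ~~ h q u} ->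
  (forall v, 0 <= x v) -> 0 <= c -> (forall u, u \notin B -> x u <= c) ->
  bil x x <= \sum_(q in Q) mass x (part B q) * (\sum_v x v - mass x (part B q))
             + #|V|%:R * c * \sum_v x v.
Proof.
move=> cf QB cQ cov x0 c0 xc; set n := \sum_v x v.
have n0 : 0 <= n by apply: sumr_ge0.
rewrite bil_deg (mass_setC _ B); apply: lerD; last first.
  rewrite -mulrA; rewrite /mass; apply: mass_le => [|u]; first exact: mulr_ge0.
  rewrite inE => uB; apply: ler_pM => //; rewrite ?xc //.
    by apply: sumr_ge0 => v _; apply: mulr_ge0.
  by apply: le_trans (deg_le_mass (A := set0) x0 _) _ => [v|];
    rewrite ?inE // /mass big_set0 subr0.
apply: le_trans (_ : \sum_(q in Q) \sum_(u in part B q) x u * (n - mass x (part B q)) <= _);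
  last by apply: ler_sum => q qQ; rewrite -mulr_suml.
under [X in _ <= X]eq_bigr do under eq_bigl do rewrite inE.
under [X in _ <= X]eq_bigr do rewrite big_mkcondr; rewrite exchange_big /=.
apply: ler_sum => u uB; have [q qQ nqu] := cov u uB.
have ge0 a : 0 <= n - mass x (part B a).
  rewrite subr_ge0 /n (mass_setC x (part B a)) lerDl; exact: sumr_ge0.
rewrite (bigD1 q) //= nqu -[X in X <= _]addr0; apply: lerD.
  apply: ler_wpM2l => //; apply: deg_le_mass => // v; rewrite inE => /andP[vB].
  by rewrite (twin_in (cherry_free_twin cf (subsetP QB q qQ) uB nqu)).
by apply: sumr_ge0 => a _; case: ifP => // _; apply: mulr_ge0.
Qed.

(** The Turan lower bound for integer vectors; rounding costs only a term linear in [n]. *)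
Lemma balanced_vector (Q : {set V}) (n : nat) : clique Q -> (0 < #|Q|)%N ->
  exists y : V -> int, [/\ forall v, 0 <= y v, \sum_v y v = n%:R &
    (#|Q|%:R - 1) * (n%:R ^+ 2 - 2 * #|Q|%:R * n%:R) <= #|Q|%:R * bil y y].
Proof.
move=> cQ Q0; have [q0 q0Q] := card_gt0P Q0; set l := #|Q|.
set a : int := (n %/ l)%N%:R; set r : int := (n %% l)%N%:R.
pose ind v : int := (v \in Q)%:R.
have sind : \sum_v ind v = l%:R.
  by rewrite /ind -natr_sum /l -sum1_card [in RHS]big_mkcond; congr (_%:R).
have bind : bil ind ind = l%:R * (l%:R - 1).
  rewrite bil_deg; transitivity (\sum_(u in Q) (l%:R - 1 : int)).
    rewrite [RHS]big_mkcond; apply: eq_bigr => u _; rewrite /ind.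
    have [uQ|_] := boolP (u \in Q); rewrite ?mul0r // mul1r /deg.
    rewrite -sind [in RHS](bigD1 u) //= [ind u]/ind uQ addrC addrK.
    rewrite (bigD1 u) //= h_irr mul0r add0r; apply: eq_bigr => v vu.
    rewrite /ind; case: (boolP (v \in Q)) => vQ; rewrite ?mulr0 // mulr1.
    by rewrite (cliqueP _ cQ u v) // eq_sym.
  by rewrite sumr_const mulr_natl.
have nE : n%:R = a * l%:R + r by rewrite /a /r -natrM -natrD -divn_eq.
have r0 : 0 <= r by [].
have rl : r < l%:R by rewrite ltr_nat ltn_mod.
have a0 : 0 <= a by [].
(* Mass [n %/ l] on every clique vertex, and the whole remainder on [q0]. The final [0] gives the
   shape required by [bil_comb]. *)
exists (fun v => a * ind v + (r * dlt q0 v + 0)); split=> [v||].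
- by rewrite addr0 addr_ge0 // mulr_ge0 // /dlt.
- by rewrite !big_split /= -!mulr_sumr sum_dlt sind big1 // nE; ring.
rewrite !(bil_comb, bil_combr).
have z0 y : bil (fun=> 0) y = 0 by rewrite /bil big1 // => i _; rewrite mul0r.
rewrite ![bil _ (fun=> 0)]bilC !z0 [bil ind (dlt _)]bilC !bil_dlt deg_dlt h_irr bind.
have d0 : 0 <= deg ind q0 by apply: sumr_ge0 => v _; apply: mulr_ge0.
rewrite nE mulr0n; have L1 : 1 <= (l%:R : int) by rewrite ler1n.
move: (l%:R : int) L1 rl => L L1 rl.
(* This is exactly the difference of the two sides of the goal. *)
have : 0 <= (L - 1) * (L ^+ 2 - (r - L) ^+ 2 + 2 * a * L * (L - r))
            + 2 * L * (a * (r * deg ind q0)).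
  apply: addr_ge0; last by rewrite !mulr_ge0 //; lia.
  by apply: mulr_ge0; nia.
lia.
Qed.

(* The error terms bound the sum of the squares [(l * a q - n) ^ 2], where [a q] is
   the mass of a part, plus a term [n ^ 2] for each part missing from the [l]
   expected ones. *)
Lemma parts_balanced (B Q Q0 : {set V}) x (c d : int) (n : nat) :
  cherry_free B -> Q \subset B ->
  clique Q -> {in B, forall u, exists2 q, q \in Q & ~~ h q u} ->
  (forall v, 0 <= x v) -> 1 <= c -> (forall u, u \notin B -> x u <= c) ->
  \sum_v x v = n%:R ->
  clique Q0 -> (#|Q| <= #|Q0|)%N -> (0 < #|Q0|)%N -> near_max x (d * n%:R) ->
  let k := #|V|%:R in let l := #|Q0|%:R in 0 <= d ->
  4 * (l ^+ 2 * k + 2 * l ^+ 3 + 2 * l ^+ 2 * d + 2 * l * k) * c < n%:R ->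
  #|Q| = #|Q0| /\ {in Q, forall q, n%:R <= 2 * l * mass x (part B q)}.
Proof.
move=> cf QB cQ cov x0 c1 xc sx cQ0 QQ0 Q00 nm k l d0 big.
have [y [y0 sy by_]] := balanced_vector n cQ0 Q00.
have := nm y y0; rewrite sx sy => /(_ erefl) nmy.
have c0 : 0 <= c by lia.
have ub := bil_le_parts cf QB cQ cov x0 c0 xc; rewrite sx in ub.
have sp := sum_mass_part x cf QB cQ cov.
have mB : n%:R - k * c <= mass x B.
  by rewrite -sx (mass_setC x B) lerBlDr lerD2l; apply: mass_le => // u; rewrite inE; apply: xc.
pose a q := mass x (part B q).
pose K : int := l ^+ 2 * k + 2 * l ^+ 3 + 2 * l ^+ 2 * d + 2 * l * k.
have l1 : 1 <= l by rewrite ler1n.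
have k0 : 0 <= k by [].
(* The upper bound for [x], the lower bound for [y] and near maximality are combined after scaling
   by powers of [l] to clear denominators; [1 <= c] absorbs the errors free of [c]. *)
have var : \sum_(q in Q) (l * a q - n%:R) ^+ 2 + (l - #|Q|%:R) * n%:R ^+ 2 <= K * c * n%:R.
  have E1 : \sum_(q in Q) (l * a q - n%:R) ^+ 2 =
     - l ^+ 2 * (\sum_(q in Q) a q * (n%:R - a q))
     + (l ^+ 2 * n%:R - 2 * l * n%:R) * mass x B + #|Q|%:R * n%:R ^+ 2.
    have -> : #|Q|%:R * n%:R ^+ 2 = \sum_(q in Q) n%:R ^+ 2 :> int.
      by rewrite sumr_const mulr_natl.
    rewrite -sp !mulr_sumr -!big_split /=.
    by apply: eq_bigr => q _; rewrite -/(a q); ring.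
  have mBn : mass x B <= n%:R.
    by rewrite -sx (mass_setC x B) lerDl; apply: sumr_ge0.
  rewrite E1 -/k in ub by_ nmy *; move: ub by_ nmy mB mBn; rewrite -/l.
  move: (mass x B) (bil x x) (bil y y) (\sum_(q in Q) _) (#|Q|%:R) l1 => M X Y S P l1.
  have : 0 <= (n%:R : int) by []. rewrite /K; clear -c1 d0 l1 k0.
  move: l k l1 k0 (n%:R : int) => l k l1 k0 N N0 ub by_ nmy mB mBn.
  have l0 : 0 <= l by lia.
  have e1 := ler_wpM2l (exprn_ge0 2 l0) ub.
  have e2 := ler_wpM2l l0 by_.
  have e3 := ler_wpM2l (exprn_ge0 2 l0) nmy.
  have e4 := ler_wpM2l (mulr_ge0 l0 N0) mB.
  have e5 := ler_wpM2l (mulr_ge0 (exprn_ge0 2 l0) N0) mBn.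
  have e6 : 0 <= (c - 1) * (2 * l ^+ 3 * N + 2 * l ^+ 2 * d * N).
    by apply: mulr_ge0; [lia | rewrite addr_ge0 // !mulr_ge0 // exprn_ge0].
  have e7 : 0 <= l ^+ 2 * N by rewrite mulr_ge0 // exprn_ge0.
  lia.
have K0 : 0 <= K by rewrite /K !addr_ge0 // !mulr_ge0 // ?exprn_ge0 //; lia.
have n0 : 0 < n%:R :> int by apply: le_lt_trans big; rewrite !mulr_ge0.
have KcN : 0 <= K * c * n%:R by rewrite !mulr_ge0.
have gap : 0 < (n%:R - 4 * (K * c)) * n%:R.
  by rewrite mulr_gt0 // subr_gt0 mulrA; exact: big.
have tot0 (P : pred V) : 0 <= \sum_(q | P q) (l * a q - n%:R) ^+ 2.
  by apply: sumr_ge0 => q _; apply: sqr_ge0.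
have Ql : #|Q|%:R <= l by rewrite ler_nat.
clearbody K; split.
  apply/eqP; rewrite eqn_leq QQ0 /=; rewrite -(ler_nat int) -/l leNgt; apply/negP => lt.
  have := tot0 (fun q => q \in Q).
  have : 0 <= (l - #|Q|%:R - 1) * n%:R ^+ 2 by rewrite mulr_ge0 ?exprn_ge0 //; lia.
  lia.
move=> q qQ; rewrite leNgt; apply/negP => lt.
rewrite (bigD1 q) //= in var; rewrite -/(a q) -mulrA in lt.
have S0 := tot0 (fun p => (p \in Q) && (p != q)).
have T0 : 0 <= (l - #|Q|%:R) * n%:R ^+ 2 by rewrite mulr_ge0 ?exprn_ge0 ?subr_ge0.
(* If [2 * z < N], then [(z - N) ^ 2] is at least [N ^ 2 / 4], which exceeds [M * N]. Hence the
   factor 4 in the hypothesis on [n]. *)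
have fin (N z S T M : int) : 0 <= S -> 0 <= T -> 0 < (N - 4 * M) * N ->
    (z - N) ^+ 2 + S + T <= M * N -> 2 * z < N -> 0 < N -> False.
  move=> s0 t0 g v zN N0.
  have : 0 <= (3 * N - 2 * z) * (N - 2 * z) by rewrite mulr_ge0 //; lia.
  lia.
exact: fin S0 T0 gap var lt n0.
Qed.
End QuadraticForm.

(** Each [c] in [X] is charged to a set [Y] of weight at least [K * w c]. Since [c] is recovered
    from any member of [Y] and a tag in [T], no element is charged more than [#|T|] times. *)
Lemma double_count (C T : finType) (w : C -> nat) (X : {set C})
    (g : C -> T -> C) (K : nat) :
  {in X, forall c, exists2 Y : {set C}, (K * w c <= \sum_(c' in Y) w c')%N &
    {in Y, forall c', exists t, c = g c' t}} ->
  (K * \sum_(c in X) w c <= #|T| * \sum_c w c)%N.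
Proof.
move=> XY; rewrite big_distrr big_distrr /=.
apply: (@leq_trans (\sum_(c in X) \sum_(c' | [exists t, c == g c' t]) w c')%N).
  apply: leq_sum => c /XY[Y le_Y gY]; apply: leq_trans le_Y _.
  rewrite [X in (X <= _)%N]big_mkcond [X in (_ <= X)%N]big_mkcond.
  apply: leq_sum => c' _ /=; case: ifP => // /gY[t ct].
  by rewrite (_ : [exists t, _] = true) //; apply/existsP; exists t; apply/eqP.
rewrite (exchange_big_dep predT) //=; apply: leq_sum => c' _.
rewrite sum_nat_const leq_mul2r; apply/orP; right.
apply: leq_trans (leq_imset_card (g c') T); apply: subset_leq_card.
apply/subsetP => c; rewrite unfold_in => /andP[_ /existsP[t /eqP->]].
exact: imset_f.
Qed.

(** * Colourings and their energy *)

Section Energy.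
Variables (V : finType) (E : rel V).
Hypothesis E_oriented : oriented E.

Definition symc : rel V := fun u v => E u v || E v u.

Lemma symc_sym : symmetric symc.
Proof. by move=> u v; rewrite /symc orbC. Qed.

Lemma symc_irr : irreflexive symc.
Proof. by move=> u; rewrite /symc orbb; apply/negbTE; case: E_oriented. Qed.

Section Colouring.
Variable n : nat.
Implicit Types c : {ffun 'I_n -> V}.

Definition energy c : nat := #|[set xy : 'I_n * 'I_n | E (c xy.1) (c xy.2)]|.

Definition cnt c (u : V) : int := \sum_x dlt (c x) u.

Lemma sum_cntM c (f : V -> int) : \sum_u cnt c u * f u = \sum_x f (c x).
Proof.
under eq_bigr do rewrite mulr_suml.
by rewrite exchange_big; apply: eq_bigr => x _; rewrite sum_dltM.
Qed.

Lemma cnt_ge0 c u : 0 <= cnt c u.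
Proof. by apply: sumr_ge0 => x _; rewrite /dlt. Qed.

Lemma cnt_card c u : cnt c u = #|[set x | c x == u]|%:R.
Proof.
rewrite /cnt -sum1_card natr_sum [RHS]big_mkcond; apply: eq_bigr => x _.
by rewrite inE /dlt eq_sym; case: eqP.
Qed.

Lemma sum_cnt c : \sum_u cnt c u = n%:R.
Proof.
transitivity (\sum_u cnt c u * 1); first by apply: eq_bigr => u _; rewrite mulr1.
by rewrite sum_cntM sumr_const card_ord.
Qed.

Lemma mass_cnt c (A : {set V}) : mass (cnt c) A = #|[set x | c x \in A]|%:R.
Proof.
rewrite -sum1_card natr_sum [RHS]big_mkcond /=.
transitivity (\sum_u cnt c u * (u \in A)%:R).
  by rewrite /mass big_mkcond; apply: eq_bigr => u _; case: ifP; rewrite ?mulr1 ?mulr0.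
by rewrite sum_cntM; apply: eq_bigr => x _; rewrite inE; case: ifP.
Qed.

Lemma bil_cnt c : bil symc (cnt c) (cnt c) = \sum_x \sum_y (symc (c x) (c y))%:R.
Proof.
rewrite bil_deg sum_cntM; apply: eq_bigr => x _; rewrite /deg.
by under eq_bigr do rewrite mulrC; rewrite sum_cntM.
Qed.

(** By antisymmetry of [E], an adjacent pair carries exactly one arc, while [bil] counts it in both
    orders. *)
Lemma energyE c : 2 * (energy c)%:R = bil symc (cnt c) (cnt c).
Proof.
have eE : (energy c)%:R = \sum_x \sum_y (E (c x) (c y))%:R :> int.
  rewrite pair_big /energy -sum1_card natr_sum big_mkcond.
  by apply: eq_bigr => -[x y] _; rewrite inE; case: ifP.
rewrite bil_cnt mulr_natl mulr2n eE [X in _ + X]exchange_big /= -big_split.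
apply: eq_bigr => x _; rewrite -big_split; apply: eq_bigr => y _ /=.
rewrite /symc; have := E_oriented.2 (c x) (c y); case: (E (c x) _) => /= [/(_ isT)|_].
  by move/negbTE=> ->.
by rewrite add0r.
Qed.

Lemma leq_energy c c' :
  (forall x y, symc (c x) (c y) -> symc (c' x) (c' y)) -> (energy c <= energy c')%N.
Proof.
move=> hom; rewrite -(ler_nat int) -(ler_pM2l (x := 2)) // !energyE !bil_cnt.
apply: ler_sum => x _; apply: ler_sum => y _.
by have := hom x y; case: symc => //= ->.
Qed.

(** List each colour [v] exactly [y v] times. This turns near maximality among colourings into near
    maximality among integer vectors. *)
Lemma colouring_of_counts (y : V -> int) : (forall v, 0 <= y v) ->
  \sum_v y v = n%:R -> exists c, cnt c =1 y.
Proof.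
move=> y0 sy; pose s := flatten [seq nseq `|y v|%N v | v <- enum V].
have ss : size s = n.
  apply/eqP; rewrite -(eqr_nat int) -sy size_flatten /shape -map_comp sumnE big_map.
  rewrite big_enum natr_sum; apply/eqP; apply: eq_bigr => v _.
  by rewrite /= size_nseq natz gez0_abs.
have sz : size s == n by rewrite ss.
exists [ffun x => tnth (Tuple sz) x] => v; rewrite cnt_card.
transitivity ((count_mem v s)%:R : int).
  congr (_%:R); rewrite cardE /enum_mem size_filter -enumT.
  rewrite -[s]/(tval (Tuple sz)) -[in RHS](map_tnth_enum (Tuple sz)).
  by rewrite [RHS]count_map; apply: eq_count => x; rewrite /= inE ffunE.
rewrite count_flatten -map_comp sumnE big_map big_enum (bigD1 v) //=.
rewrite count_nseq /= eqxx mul1n big1 ?addn0 ?natz ?gez0_abs // => u uv.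
by rewrite count_nseq /= (negbTE uv).
Qed.

Definition recolour c (m : 'I_n * V) : {ffun 'I_n -> V} :=
  [ffun x => if x == m.1 then m.2 else c x].

Lemma cnt_recolour c y b : cnt (recolour c (y, b)) =1 shift (cnt c) 1 b (c y).
Proof.
move=> u; rewrite /shift /cnt mul1r mulN1r (bigD1 y) //= [in RHS](bigD1 y) //=.
rewrite ffunE eqxx addKr; congr (_ + _); apply: eq_bigr => x xy.
by rewrite ffunE (negbTE xy).
Qed.

Lemma energy_recolour c y b :
  (energy (recolour c (y, b)))%:R =
  (energy c)%:R + (deg symc (cnt c) b - deg symc (cnt c) (c y)) - (symc b (c y))%:R :> int.
Proof.
have := energyE (recolour c (y, b)).
rewrite (eq_bil _ (cnt_recolour _ _ _) (cnt_recolour _ _ _)).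
rewrite bil_shift ?symc_irr // -?energyE; try exact: symc_sym; try exact: symc_irr.
lia.
Qed.

Lemma typical_near_max c (d : nat) :
  (forall c', (energy c' <= energy c + d)%N) -> near_max symc (cnt c) d%:R.
Proof.
move=> typ y y0; rewrite sum_cnt => /(colouring_of_counts y0)[c' c'y].
rewrite -(eq_bil _ c'y c'y) -!energyE; have := typ c'; lia.
Qed.

(** The moves correct the vertices where [c] and [c0] differ. The list is padded to length exactly
    [m] by moves giving vertex [0] its colour in [c], which are harmless. *)
Lemma foldr_recolour c c0 (m : nat) : (0 < n)%N ->
  (#|[set x | c x != c0 x]| <= m)%N ->
  exists t : m.-tuple ('I_n * V), c = foldr (fun a b => recolour b a) c0 t.
Proof.
move=> n0 dm; pose s := enum [set x | c x != c0 x] ++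
  nseq (m - #|[set x | c x != c0 x]|) (Ordinal n0).
have sz : size [seq (x, c x) | x <- s] == m.
  by rewrite size_map size_cat size_nseq -cardE subnKC.
exists (Tuple sz); apply/ffunP => x /=.
have -> (s' : seq 'I_n) : foldr (fun a b => recolour b a) c0 [seq (x, c x) | x <- s'] x =
    if x \in s' then c x else c0 x.
  elim: s' => [|a s' IH] //=; rewrite ffunE IH inE /=.
  by case: eqP => [->|].
case: ifP => //; rewrite mem_cat mem_enum inE => /negbT; rewrite negb_or negbK.
by case/andP => /eqP.
Qed.

End Colouring.
End Energy.

(** Pigeonhole: the [#|V| + 1] disjoint intervals from [a * M ^ s] to [a * M ^ s.+1] cannot all
    contain one of the [#|V|] values of [x]. *)
Lemma scale_gap (V : finType) (x : V -> nat) (a M : nat) : (0 < a)%N -> (0 < M)%N ->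
  exists2 s, (s <= #|V|)%N &
    forall v, (x v < a * M ^ s)%N || (a * M ^ s.+1 <= x v)%N.
Proof.
move=> a0 M0.
have [[s sk] gap] : exists s : 'I_#|V|.+1,
    [forall v, (x v < a * M ^ s)%N || (a * M ^ s.+1 <= x v)%N].
  apply/existsP; apply: contraT; rewrite negb_exists => /forallP nex.
  have /fin_all_exists[f fP] (s : 'I_#|V|.+1) :
      exists v, (a * M ^ s <= x v < a * M ^ s.+1)%N.
    move: (nex s); rewrite negb_forall => /existsP[v].
    by rewrite negb_or -leqNgt -ltnNge => ?; exists v.
  have lt_f (s s' : 'I_#|V|.+1) : (s < s')%N -> f s != f s'.
    move=> ss'; apply/eqP => e; have /andP[_] := fP s; have /andP[+ _] := fP s'.
    rewrite -e => le1 lt1; have := leq_ltn_trans le1 lt1.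
    by rewrite ltnNge leq_mul2l leq_pexp2l ?orbT.
  have f_inj : injective f.
    move=> s s' e; apply/val_inj/eqP; case: ltngtP => // /lt_f; by rewrite e eqxx.
  by have := leq_card f f_inj; rewrite card_ord ltnn.
exists s => // v; exact: (forallP gap v).
Qed.

(** * Structure of typical colourings *)

Section Dichotomy.
Variables (V : finType) (E : rel V) (l : nat).
Hypothesis E_oriented : oriented E.
Hypothesis clique_le : forall Q : {set V}, clique (symc E) Q -> (#|Q| <= l)%N.

Local Notation h := (symc E).
Let h_sym := symc_sym E.
Let h_irr := symc_irr E_oriented.

Section Core.
Variables (B Q : {set V}).
Hypothesis cf : cherry_free h B.
Hypothesis QB : Q \subset B.
Hypothesis cQ : clique h Q.
Hypothesis cov : {in B, forall u, exists2 q, q \in Q & ~~ h q u}.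
Hypothesis Ql : #|Q| = l.

(* Otherwise [u] and one neighbour of [u] in each part form a clique of size [l + 1]. *)
Lemma misses_part u : exists2 q, q \in Q & {in part h B q, forall w, ~~ h u w}.
Proof.
suff /exists_inP[q qQ /forall_inP] : [exists q in Q, [forall w in part h B q, ~~ h u w]].
  by exists q.
apply: contraT => /exists_inPn no.
have /fin_all_exists[f fP] q : exists w, q \in Q -> [&& w \in B, ~~ h q w & h u w].
  have [qQ|_] := boolP (q \in Q); last by exists u.
  have /forall_inPn[w] := no q qQ; rewrite inE negbK => /andP[wB nqw] uw.
  by exists w; rewrite wB nqw uw.
have f_inj : {in Q &, injective f}.
  move=> q q' qQ q'Q e; have /and3P[fB nq _] := fP q qQ; have /and3P[_ nq' _] := fP q' q'Q.
  by apply: (missed_uniq h_sym cf QB cQ fB qQ q'Q nq); rewrite e.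
have cfQ : clique h (f @: Q).
  apply/cliqueP => _ _ /imsetP[q qQ ->] /imsetP[q' q'Q ->] neq.
  have /and3P[fB nq _] := fP q qQ; have /and3P[f'B nq' _] := fP q' q'Q.
  have tw := cherry_free_twin h_sym cf (subsetP QB q qQ) fB nq.
  rewrite -(twin_in tw) //; apply: contraNT neq => nq'2.
  by rewrite (missed_uniq h_sym cf QB cQ f'B qQ q'Q nq'2 nq').
have ufQ : {in f @: Q, forall w, h u w} by move=> _ /imsetP[q /fP/and3P[_ _ ?] ->].
have ufn : u \notin f @: Q by apply/negP => /ufQ; rewrite h_irr.
have := clique_le (clique_add h_sym cfQ ufQ).
by rewrite cardsU1 ufn card_in_imset // Ql ltnn.
Qed.

(** Replacing [q] in [Q] by two adjacent twins would give a clique of size [l + 1]. *)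
Lemma twin_nonadj u v q : q \in Q -> twin h B u q -> twin h B v q -> ~~ h u v.
Proof.
move=> qQ tu tv; apply/negP => uv.
have adj w : twin h B w q -> {in Q :\ q, forall q', h w q'}.
  move=> tw q'; rewrite !inE => /andP[q'q q'Q].
  by rewrite (twin_in tw) ?(subsetP QB) // (cliqueP _ _ cQ) // eq_sym.
have nQ w : twin h B w q -> w \notin Q :\ q.
  by move=> tw; apply/negP => wQ; have := adj w tw w wQ; rewrite h_irr.
have cQ' : clique h (Q :\ q).
  by apply/cliqueP => a b; rewrite !inE => /andP[_ aQ] /andP[_ bQ]; apply: (cliqueP _ _ cQ).
have cv := clique_add h_sym cQ' (adj v tv).
have uadj : {in v |: (Q :\ q), forall w, h u w}.
  by move=> w /setU1P[->|] //; apply: adj.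
have cuv := clique_add h_sym cv uadj.
have uvn : u == v = false by apply/eqP => e; move: uv; rewrite e h_irr.
have := clique_le cuv; rewrite !cardsU1 in_setU1 uvn !nQ //.
by rewrite -Ql (cardsD1 q Q) qQ /= !add1n ltnn.
Qed.

Lemma twin_adj u v q q' : q \in Q -> q' \in Q -> q != q' -> v \in B ->
  twin h B u q -> twin h B v q' -> h u v.
Proof.
move=> qQ q'Q qq' vB tu tv; rewrite (twin_in tu) // h_sym (twin_in tv) ?(subsetP QB) //.
by rewrite (cliqueP _ _ cQ) // eq_sym.
Qed.

End Core.

Section Events.
Variable n : nat.
Implicit Types c : {ffun 'I_n -> V}.

Definition splice c (R : {set 'I_n}) v : {ffun 'I_n -> V} :=
  [ffun x => if x \in R then v else c x].

Definition suboptimal c d := exists c', (energy E c + d < energy E c')%N.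

Definition improvable c r :=
  exists m, (energy E c + r <= energy E (recolour c m))%N.

(** Because [c0] avoids [v], the set [R] can be read off from [splice c0 R v], so distinct [R] give
    distinct colourings. *)
Definition diluted c m D := exists c0 u v,
  [/\ (#|[set x | c x != c0 x]| <= m)%N, (n <= D * #|[set x | c0 x == u]|)%N,
      forall x, c0 x != v &
      forall R : {set 'I_n}, R \subset [set x | c0 x == u] ->
        (energy E c <= energy E (splice c0 R v))%N].

(** The colours lie in a set [B] on which [symc E] is complete [l]-partite, with transversal [Q]. *)
Definition multipartite_image c := exists B Q : {set V},
  [/\ cherry_free h B, Q \subset B, clique h Q, #|Q| = l &
   {in B, forall u, exists2 q, q \in Q & ~~ h q u}] /\ forall x, c x \in B.

(** The colour of [y] misses the whole part of some [q]. If it also missed a [w] of [B] adjacent to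
    [q], recolouring [y] by [q] would raise its degree by at least [cnt c w] minus the mass outside
    [B], hence by [theta]. At most 1 is lost if [q] and [c y] are adjacent, and [r < theta] absorbs
    it. *)
Lemma colour_twin c (B Q : {set V}) (theta r : nat) y :
  cherry_free h B -> Q \subset B -> clique h Q ->
  {in B, forall u, exists2 q, q \in Q & ~~ h q u} -> #|Q| = l ->
  (forall v, if v \in B then (#|V|.+1 * theta)%:R <= cnt c v
             else cnt c v <= theta%:R) ->
  (r < theta)%N -> ~ improvable c r -> exists2 q, q \in Q & twin h B (c y) q.
Proof.
move=> cf QB cQ cov Ql gap rt nimp.
have [q qQ miss] := misses_part cf QB cQ Ql (c y); exists q => //.
apply/forall_inP => w wB; apply/eqP.
have [qw|nqw] := boolP (h q w); last first.
  by apply/negbTE/miss; rewrite inE wB.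
apply/idP; apply: contraT => nyw; case: nimp; exists (y, q).
rewrite -(ler_nat int) natrD energy_recolour //.
have cy0 := cnt_ge0 c.
have big := gap w; rewrite wB in big.
have wP : w \notin part h B q by rewrite inE qw andbF.
have dy : deg h (cnt c) (c y) <= \sum_v cnt c v - mass (cnt c) (w |: part h B q).
  by apply: deg_le_mass => // v /setU1P[->|/miss].
have dq : mass (cnt c) (B :\: part h B q) <= deg h (cnt c) q.
  rewrite /mass big_mkcond; apply: ler_sum => v _; rewrite !inE.
  have [vB|] := boolP (v \in B); last by rewrite andbF mulr_ge0.
  by rewrite andbT; case: (h q v) => /=; rewrite ?mul1r // mulr_ge0.
have small : mass (cnt c) (~: B) <= #|V|%:R * theta%:R.
  by apply: mass_le => // v; rewrite inE => /negbTE vB; have := gap v; rewrite vB.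
have mB : mass (cnt c) B = mass (cnt c) (B :\: part h B q) + mass (cnt c) (part h B q).
  rewrite /mass (big_setID (part h B q)) /= addrC; congr (_ + _).
  by apply: eq_bigl => v; rewrite !inE; case: (v \in B).
have mU : mass (cnt c) (w |: part h B q) = cnt c w + mass (cnt c) (part h B q).
  by rewrite /mass big_setU1.
have := mass_setC (cnt c) B; move: dy; rewrite mU.
have := ler_nat int (symc E q (c y)) 1; rewrite leq_b1.
move: big; rewrite natrM -addn1 natrD.
lia.
Qed.

Lemma dichotomy c (Q0 : {set V}) (d theta t r : nat) :
  clique h Q0 -> #|Q0| = l -> (0 < l)%N ->
  (forall v, (#|[set x | c x == v]| < theta)%N ||
             (#|V|.+1 * theta <= #|[set x | c x == v]|)%N) ->
  (2 * t <= theta)%N -> (3 * (d * n) < t ^ 2)%N -> (r < theta)%N ->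
  (4 * (l ^ 2 * #|V| + 2 * l ^ 3 + 2 * l ^ 2 * d + 2 * l * #|V|) * theta < n)%N ->
  [\/ suboptimal c (d * n), improvable c r, diluted c (#|V| * theta) (2 * l * #|V|)
    | multipartite_image c].
Proof.
move=> cQ0 Q0l l0 gap tth dt rth nbig.
have [?|nsub] := pselect (suboptimal c (d * n)); first by constructor 1.
have [?|nimp] := pselect (improvable c r); first by constructor 2.
have nm : near_max h (cnt c) (d%:R * n%:R).
  rewrite -natrM; apply: typical_near_max => // c'; rewrite leqNgt; apply/negP => lt.
  by apply: nsub; exists c'.
pose B := [set v | (theta <= #|[set x | c x == v]|)%N].
have cB v : if v \in B then (#|V|.+1 * theta)%:R <= cnt c v else cnt c v <= theta%:R.
  rewrite inE cnt_card; have := gap v.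
  by case: leqP => [|lt _]; rewrite ler_nat // ltnW.
have cn0 := cnt_ge0 c.
have cf : cherry_free h B.
  move=> u v w uB vB wB nuv nvw; apply/negP => uw.
  have Bge a : a \in B -> theta%:R <= cnt c a.
    by rewrite inE cnt_card ler_nat.
  have := near_max_no_cherry (t := t%:R) h_sym h_irr cn0 nm _ _ _ _ nuv nvw uw.
  have := Bge u uB; have := Bge v vB; have := Bge w wB; lia.
have [Q [QB cQ cov]] := clique_covering h_sym h_irr B.
have small v : v \notin B -> cnt c v <= theta%:R.
  by move/negbTE => vB; have := cB v; rewrite vB.
have th1 : 1 <= theta%:R :> int by rewrite ler1n; lia.
have Qle : (#|Q| <= #|Q0|)%N by rewrite Q0l clique_le.
have Q0_gt0 : (0 < #|Q0|)%N by rewrite Q0l.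
have := parts_balanced h_sym h_irr cf QB cQ cov cn0 th1 small
    (sum_cnt c) cQ0 Qle Q0_gt0 nm (ler0n _ _).
rewrite Q0l -!natrX -!natrM -!natrD -!natrM ltr_nat => /(_ nbig)[Ql heavy].
have [allB|/existsNP[y0 yB]] := pselect (forall x, c x \in B).
  by constructor 4; exists B, Q.
constructor 3; move/negP: yB => yB.
have /fin_all_exists2[tau tauQ tauP] := fun y => colour_twin y cf QB cQ cov Ql cB rth nimp.
have k0 : (0 < #|V|)%N by apply/card_gt0P; exists (c y0).
(* The part of [tau y0] has mass at least [n / (2 * l)], so one of its at most [#|V|] colours has a
   [#|V|]-th of that. *)
have [u uP un] : exists2 u, u \in part h B (tau y0) &
    (n <= 2 * l * #|V| * #|[set x | c x == u]|)%N.
  apply/exists_inP; apply: contraT => /exists_inPn no.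
  have n1 : (1 <= n)%N by exact: leq_ltn_trans (leq0n _) (ltn_ord y0).
  have le_n : mass (fun u => (2 * l * #|V|)%:R * cnt c u) (part h B (tau y0)) <=
      #|V|%:R * n.-1%:R.
    by apply: mass_le => // u /no; rewrite cnt_card -natrM ler_nat; lia.
  move: le_n; rewrite /mass -mulr_sumr -/(mass _ _).
  have := heavy _ (tauQ y0); move: (mass _ _) => M.
  have : 1 <= (#|V|%:R : int) by rewrite ler1n.
  have -> : n.-1%:R = n%:R - 1 :> int by lia.
  rewrite !natrM; nia.
have uB : u \in B by move: uP; rewrite inE => /andP[].
(* Colours outside [B] give way to the clique vertex they are twins of; only small classes
   change. *)
pose c0 : {ffun 'I_n -> V} := [ffun x => if c x \in B then c x else tau x].
have c0B x : c0 x \in B by rewrite ffunE; case: ifP => // _; apply: (subsetP QB).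
have c0tau x : ~~ h (tau x) (c0 x).
  rewrite ffunE; case: ifP => [cxB|_]; last by rewrite h_irr.
  by rewrite -(twin_in (tauP x)) // h_irr.
exists c0, u, (c y0); split.
- rewrite -(ler_nat int); apply: (@le_trans _ _ (mass (cnt c) (~: B))).
    rewrite mass_cnt ler_nat; apply: subset_leq_card; apply/subsetP => x.
    by rewrite !inE ffunE inE; case: ifP; rewrite ?eqxx.
  by rewrite natrM; apply: mass_le => // v; rewrite inE => /small.
- apply: leq_trans un _; rewrite leq_mul2l; apply/orP; right.
  apply: subset_leq_card; apply/subsetP => x; rewrite inE => /eqP cx.
  by rewrite inE ffunE cx uB.
- by move=> x; apply: contraNneq yB => <-.
move=> R Ru; apply: leq_energy => // x y xy.
(* Adjacent vertices have different [tau], and the spliced colours remain twins of [tau]. By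
   [twin_adj] adjacency survives once one end has its colour in [B]; otherwise both ends lie in [R]
   and share [tau y0]. *)
have tau_ne : tau x != tau y.
  apply/eqP => e; have := twin_nonadj QB cQ Ql (tauQ x) (tauP x).
  by rewrite e => /(_ _ (tauP y)); rewrite xy.
have Rtau z : z \in R -> tau z = tau y0.
  move=> /(subsetP Ru); rewrite inE => /eqP c0z.
  apply: (missed_uniq h_sym cf QB cQ uB (tauQ z) (tauQ y0)).
    by rewrite -c0z.
  by move: uP; rewrite inE => /andP[].
have sP z : twin h B (splice c0 R (c y0) z) (tau z).
  rewrite ffunE; case: ifP => [/Rtau -> //|_].
  rewrite ffunE; case: ifP => // _; exact/forall_inP.
have sB z : z \notin R -> splice c0 R (c y0) z \in B by rewrite ffunE => /negbTE ->.
have [yR|/sB yB'] := boolP (y \in R); last first.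
  exact: twin_adj (tauQ x) (tauQ y) tau_ne yB' (sP x) (sP y).
have [xR|/sB xB'] := boolP (x \in R).
  by move: tau_ne; rewrite !Rtau // eqxx.
by rewrite symc_sym; apply: (twin_adj QB cQ (tauQ y) (tauQ x) _ xB' (sP y) (sP x)); rewrite eq_sym.
Qed.
End Events.
End Dichotomy.

(** * Exceptional colourings are rare *)

Section RareEvents.
Variables (V : finType) (E : rel V) (n : nat).
Implicit Types c : {ffun 'I_n -> V}.

Definition weight (X : {set {ffun 'I_n -> V}}) : nat := \sum_(c in X) 2 ^ energy E c.

Lemma weightT : weight setT = (\sum_(c : {ffun 'I_n -> V}) 2 ^ energy E c)%N.
Proof. by rewrite /weight; apply: eq_bigl => c; rewrite inE. Qed.

(** The tag is the original colouring itself, so one heavier colouring is compared with all of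
    them. *)
Lemma weight_suboptimal d :
  (2 ^ d * weight [set c | `[< suboptimal E c d >]] <= #|V| ^ n * weight setT)%N.
Proof.
rewrite weightT.
rewrite -[in X in (_ <= X * _)%N](card_ord n) -card_ffun.
apply: (double_count (g := fun _ c => c)) => c; rewrite inE => /asboolP[c' lt].
exists [set c']; last by move=> c'' _; exists c.
by rewrite big_set1 -expnD leq_exp2l // addnC ltnW.
Qed.

(** The tag records the recoloured vertex and its old colour, which undoes the move. *)
Lemma weight_improvable r :
  (2 ^ r * weight [set c | `[< improvable E c r >]] <= (n * #|V|) * weight setT)%N.
Proof.
rewrite weightT.
rewrite -[in X in (_ <= X * _ * _)%N](card_ord n) -card_prod.
apply: (double_count (g := @recolour V n)) => c; rewrite inE => /asboolP[m le].
exists [set recolour c m]; first by rewrite big_set1 -expnD leq_exp2l // addnC.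
move=> _ /set1P ->; exists (m.1, c m.1); apply/ffunP => x; rewrite !ffunE /=.
by case: eqP => [->|].
Qed.

Lemma dilutedW c m m' D : (m <= m')%N -> diluted E c m D -> diluted E c m' D.
Proof.
move=> mm [c0 [u [v [dm *]]]]; exists c0, u, v; split=> //; exact: leq_trans mm.
Qed.

(** Each such [c] has at least [2 ^ (n %/ D)] splices, none of lower energy. Turning [v] back into
    [u] recovers [c0], and [m] recolourings then recover [c]; the tag consists of [u], [v] and these
    moves. *)
Lemma weight_diluted m D : (0 < n)%N -> (0 < D)%N ->
  (2 ^ (n %/ D) * weight [set c | `[< diluted E c m D >]] <=
     #|V| ^ 2 * (n * #|V|) ^ m * weight setT)%N.
Proof.
move=> n0 D0.
rewrite weightT.
pose T : finType := ((V * V) * m.-tuple ('I_n * V))%type.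
have <- : #|T| = (#|V| ^ 2 * (n * #|V|) ^ m)%N.
  by rewrite !card_prod card_tuple card_prod card_ord mulnn.
pose g c (t : T) := foldr (fun a b => recolour b a)
  [ffun x => if c x == t.1.2 then t.1.1 else c x] t.2.
apply: (double_count (g := g)) => c; rewrite inE => /asboolP[c0 [u [v [dm nu c0v le]]]].
pose cls := [set x | c0 x == u]; pose sp (R : {set 'I_n}) := splice c0 R v.
have inv (R : {set 'I_n}) : R \subset cls ->
    [ffun x => if sp R x == v then u else sp R x] = c0.
  move=> Rc; apply/ffunP => x; rewrite !ffunE; case: (boolP (x \in R)) => xR.
    by have := subsetP Rc x xR; rewrite inE eqxx => /eqP.
  by rewrite (negbTE (c0v x)).
have inj : {in powerset cls &, injective sp}.
  move=> R R' _ _ /ffunP e; apply/setP => x; have := e x; rewrite !ffunE.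
  have /eqP c0x := c0v x.
  by case: (x \in R); case: (x \in R') => // /esym //.
exists (sp @: powerset cls); last first.
  move=> c' /imsetP[R]; rewrite inE => Rc ->.
  have [t ct] := foldr_recolour n0 dm.
  by exists ((u, v), t); rewrite /g /= inv.
apply: leq_trans (_ : (\sum_(c' in (sp @: powerset cls)) 2 ^ energy E c <= _)%N).
  rewrite sum_nat_const card_in_imset // card_powerset leq_mul2r; apply/orP; right.
  by rewrite leq_exp2l // -ltnS ltn_divLR // (leq_ltn_trans nu) // mulnC ltn_pmul2r.
apply: leq_sum => c' /imsetP[R]; rewrite inE => Rc ->.
by rewrite leq_exp2l // le.
Qed.

(** For a fixed colouring the admissible digraphs are exactly the subsets of the pull-back of [E],
    which has no loops. *)
Lemma card_Dcoloured (X : {set {ffun 'I_n -> V}}) : oriented E ->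
  #|[set cg in Dcoloured_set E n | cg.1 \in X]| = weight X.
Proof.
move=> Eo; rewrite -sum1_card /weight.
rewrite (eq_bigl (fun cg : {ffun 'I_n -> V} * {set 'I_n * 'I_n} =>
  (cg.1 \in X) && (cg.2 \in powerset [set xy | E (cg.1 xy.1) (cg.1 xy.2)]))).
  rewrite -(pair_big_dep (mem X) (fun c G => G \in powerset [set xy | E (c xy.1) (c xy.2)])
    (fun _ _ => 1%N)) /=.
  by apply: eq_bigr => c _; rewrite sum1_card card_powerset.
case=> c G; rewrite !inE /= andbC; congr (_ && _); rewrite /is_Dcoloured.
apply/andP/subsetP => [[_ /forallP hom] [x y] xyG|sub].
  by rewrite inE /=; have /forallP/(_ y)/implyP := hom x; apply.
split; last first.
  apply/forallP => x; apply/forallP => y; apply/implyP => /sub; by rewrite inE.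
by apply/forallP => x; apply/negP => /sub; rewrite inE /= (negbTE (Eo.1 _)).
Qed.
End RareEvents.

(** * Growth estimates *)

Lemma nat_sqrt n : exists r, (r ^ 2 <= n < r.+1 ^ 2)%N.
Proof.
elim: n => [|n [r /andP[rn nr]]]; first by exists 0%N.
have [le|lt] := leqP (r.+1 ^ 2) n.+1; last by exists r; rewrite lt leqW.
exists r.+1; rewrite le; apply: leq_ltn_trans nr _; by rewrite ltn_exp2r.
Qed.

(** With [t = s %/ 4] and [X = 2 ^ t], one has [s.+1 <= 4 * X] and [16 * P <= X], so the left side
    is at most [X ^ 3]. *)
Lemma square_leq_exp2 P : exists S, forall s, (S <= s)%N -> (P * s.+1 ^ 2 <= 2 ^ s)%N.
Proof.
exists (4 * (16 * P))%N => s Ss; pose t := (s %/ 4)%N.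
have Pt : (16 * P <= t)%N by rewrite leq_divRL // mulnC.
have st : (s.+1 <= 4 * t.+1)%N by rewrite mulnC -ltn_divLR // ltnS.
have t2 := ltn_expl t (leqnn 2).
have tS : (4 * t <= s)%N by rewrite mulnC leq_trunc_div.
apply: leq_trans (_ : (2 ^ (4 * t) <= _)%N); last by rewrite leq_exp2l.
have s2 : (s.+1 ^ 2 <= 16 * (2 ^ t) ^ 2)%N by rewrite -(expnMn 4 _ 2) leq_exp2r //; lia.
have x1 : (1 <= 2 ^ t)%N by rewrite expn_gt0.
rewrite [(4 * t)%N]mulnC expnM; move: (2 ^ t)%N t2 s2 x1 => X t2 s2 x1.
apply: leq_trans (leq_mul (leqnn P) s2) _.
rewrite mulnA [(P * 16)%N]mulnC; apply: (@leq_trans (X * X ^ 2)%N).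
  by rewrite leq_mul2r; apply/orP; right; lia.
by rewrite -expnS leq_pexp2l.
Qed.

(** With [s = r %/ F], both [J] and [n * k] are at most [2 ^ s]. The last product is thus at most
    [2 ^ (s * (1 + m * r))], and [s * m.+1 * r * D <= r ^ 2 <= n]. *)
Lemma growth (J k m D : nat) : (0 < D)%N -> exists N, forall n, (N <= n)%N ->
  exists r, [/\ (r ^ 2 <= n < r.+1 ^ 2)%N, (J <= r)%N, (J * n <= 2 ^ r)%N &
    (J * (n * k) ^ (m * r) <= 2 ^ (n %/ D))%N].
Proof.
move=> D0; pose F := (m.+1 * D)%N.
have F0 : (0 < F)%N by rewrite muln_gt0.
(* The factor [F ^ 2] comes from [n < r.+1 ^ 2 <= (s.+1 * F) ^ 2]. *)
have [S hS] := square_leq_exp2 (J.+1 * k.+1 * F ^ 2).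
exists ((F * (S + J).+1) ^ 2)%N => n Nn; have [r rn] := nat_sqrt n; exists r.
have /andP[r2n nr2] := rn; pose s := (r %/ F)%N.
have Fr : (F * (S + J).+1 <= r)%N.
  by rewrite -ltnS -(@ltn_exp2r _ _ 2) // (leq_ltn_trans Nn).
have sSJ : ((S + J).+1 <= s)%N by rewrite leq_divRL // mulnC.
have sr : (s <= r)%N by rewrite leq_div.
have rs : (r.+1 <= s.+1 * F)%N by rewrite -ltn_divLR.
have nB : (J.+1 * k.+1 * n <= 2 ^ s)%N.
  apply: leq_trans (hS s _); last by lia.
  rewrite -[X in (_ <= X)%N]mulnA leq_mul2l -expnMn; apply/orP; right.
  by apply: ltnW; apply: leq_trans nr2 _; rewrite leq_exp2r // mulnC.
have s0 : (J <= 2 ^ s)%N by apply: leq_trans (ltnW (ltn_expl s (leqnn 2))); lia.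
split=> //; first by lia.
  apply: leq_trans (_ : (2 ^ s <= _)%N); last by rewrite leq_exp2l.
  by apply: leq_trans nB; rewrite leq_mul2r (leq_trans (leqnSn J)) ?orbT // leq_pmulr.
apply: (@leq_trans (2 ^ s * (2 ^ s) ^ (m * r))%N).
  apply: leq_mul => //; case: (posnP (m * r)) => [->//|mr0].
  rewrite leq_exp2r //; apply: leq_trans nB; rewrite mulnC leq_mul2r.
  by rewrite (leq_trans (leqnSn k)) ?orbT // leq_pmull.
rewrite -expnS -expnM leq_exp2l // leq_divRL //.
apply: leq_trans r2n; rewrite -mulnn.
have le1 : (s * F <= r)%N by rewrite leq_trunc_div.
apply: leq_trans (leq_mul le1 (leqnn r)); rewrite /F.
have r1 : (1 <= r)%N by lia.
have : (1 + m * r <= m.+1 * r)%N by rewrite mulSn leq_add2r.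
move=> le2; rewrite -!mulnA leq_mul2l; apply/orP; right.
by rewrite mulnC [(D * r)%N]mulnC mulnA [X in (_ <= X)%N]mulnC leq_mul2l le2 orbT.
Qed.

(** * Between oriented subgraphs and the underlying graph *)

Section Transfer.
Variables (V : finType) (E : rel V).
Hypothesis E_oriented : oriented E.
Local Notation h := (symc E).

Definition restrict (W : {set V}) : rel V := fun u v => [&& u \in W, v \in W & E u v].

Lemma restrict_orientation (W : {set V}) :
  is_orientation_of W (restrict W) (fun u v => restrict W u v || restrict W v u).
Proof.
move=> u v uW vW; split=> //; rewrite /restrict uW vW /=.
by apply/andP => -[/E_oriented.2/negbTE ->].
Qed.

Lemma restrict_symc (W : {set V}) u v : u \in W -> v \in W ->
  restrict W u v || restrict W v u = h u v.
Proof. by move=> uW vW; rewrite /restrict uW vW. Qed.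

Lemma contains_clique (Q : {set V}) :
  clique h Q -> contains_oriented_complete E #|Q|.
Proof.
move=> cQ; exists Q, (restrict Q), (fun u v => restrict Q u v || restrict Q v u).
split; [by move=> u v /and3P[]|exact: restrict_orientation|].
exists enum_val; split=> [|| i j].
- exact: enum_val_inj.
- apply/setP => u; apply/imsetP/idP => [[i _ ->]|uQ]; first exact: enum_valP.
  by exists (enum_rank_in uQ u); rewrite ?inE // enum_rankK_in.
rewrite restrict_symc ?enum_valP //.
have [->|ij] := eqVneq i j; first by rewrite symc_irr.
by rewrite (cliqueP _ _ cQ) ?enum_valP // (inj_eq enum_val_inj).
Qed.

Lemma clique_of_contains l : contains_oriented_complete E l ->
  exists2 Q : {set V}, clique h Q & #|Q| = l.
Proof.
move=> [W [F [U [sub ori [f [f_inj fW UE]]]]]]; exists W; last first.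
  by rewrite -fW card_imset // cardsT card_ord.
apply/cliqueP => u v uW vW uv; move: (uW) (vW) uv; rewrite -fW.
move=> /imsetP[i _ ui] /imsetP[j _ vj] uv.
have : U u v by rewrite ui vj UE; apply: contraNneq uv => e; rewrite ui vj e.
rewrite (ori u v uW vW).1 /symc => /orP[] /sub[_ _ ->] //; exact: orbT.
Qed.

(** A vertex [u] of [B] is a copy of [tau u], the unique element of [Q] that it misses. Elements of
    [Q] are copies of themselves, so no set of copies is empty. *)
Lemma multipartite_blowup l n (c : {ffun 'I_n -> V}) (G : {set 'I_n * 'I_n}) :
  (0 < l)%N -> is_Dcoloured E c G -> multipartite_image E l c ->
  exists (W : {set V}) (F : rel V),
    oriented_blowup_subgraph E l W F /\ image_contained_in c G W F.
Proof.
move=> l0 /andP[_ /forallP hom] [B [Q [[cf QB cQ Ql cov] cB]]].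
exists B, (restrict B); split; last first.
  split=> // x y xyG; rewrite /restrict !cB /=.
  by have /forallP/(_ y)/implyP := hom x; apply.
split; first by move=> u v /and3P[].
exists (fun u v => restrict B u v || restrict B v u).
split; first exact: restrict_orientation.
subst l; have [q0 q0Q] := card_gt0P l0.
have /fin_all_exists[tau tauP] u : exists q, u \in B -> q \in Q /\ ~~ h q u.
  have [uB|_] := boolP (u \in B); last by exists u.
  by have [q qQ nqu] := cov u uB; exists q.
have uniq u q : u \in B -> q \in Q -> ~~ h q u -> tau u = q.
  move=> uB qQ nqu; have [tQ ntu] := tauP u uB.
  exact: (missed_uniq (symc_sym E) cf QB cQ uB tQ qQ ntu nqu).
exists (fun u => enum_rank_in q0Q (tau u)); split.
  apply/setP => i; rewrite inE; apply/imsetP; have iQ := enum_valP i.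
  have iB := subsetP QB _ iQ; exists (enum_val i) => //.
  by rewrite (uniq _ (enum_val i)) ?enum_valK_in // symc_irr.
move=> u v uB vB; rewrite restrict_symc //.
have [uQ nu] := tauP u uB; have [vQ nv] := tauP v vB.
have -> : (enum_rank_in q0Q (tau u) == enum_rank_in q0Q (tau v)) = (tau u == tau v).
  apply/idP/idP => /eqP e; apply/eqP; last by rewrite e.
  by rewrite -(enum_rankK_in q0Q uQ) e enum_rankK_in.
have tw := cherry_free_twin (symc_sym E) cf (subsetP QB _ uQ) uB nu.
rewrite -(twin_in tw) //; apply/idP/idP => [uv|/eqP ne].
  by apply: contraNneq nv => <-.
by apply: contraT => /(uniq v _ vB uQ) e; case: ne.
Qed.
End Transfer.

(** * Choice of parameters and passage to the limit *)

Lemma threshold_slack n r k :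
  (n < 4 * r ^ 2)%N -> (3 * (k.+1 * n) < (4 * k.+1 * r) ^ 2)%N.
Proof.
move=> n4; rewrite (_ : (4 * k.+1 * r) ^ 2 = 16 * (k.+1 * (k.+1 * r ^ 2)))%N; last by ring.
have kn : (k.+1 * n < k.+1 * (4 * r ^ 2))%N by rewrite ltn_pmul2l.
have kr : (k.+1 * r ^ 2 <= k.+1 * (k.+1 * r ^ 2))%N by rewrite leq_pmull.
by move: kn kr; rewrite mulnCA; lia.
Qed.

Lemma exceptional_weight (V : finType) (E : rel V) (l J : nat) :
  oriented E -> (0 < #|V|)%N -> (0 < l)%N ->
  (exists2 Q : {set V}, clique (symc E) Q & #|Q| = l) ->
  (forall Q : {set V}, clique (symc E) Q -> (#|Q| <= l)%N) ->
  exists N, forall n, (N <= n)%N ->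
    (J * weight E [set c : {ffun 'I_n -> V} | ~~ `[< multipartite_image E l c >]]
       <= weight E [set: {ffun 'I_n -> V}])%N.
Proof.
move=> Eo k0 l0 [Q0 cQ0 Q0l] cle; set k := #|V|.
(* [A * r] bounds [theta] at every scale [s <= k]. In [J'], the first term serves the three weight
   comparisons and the second makes [4 * K * theta < n]. *)
pose A := (8 * k.+1 * k.+1 ^ k)%N.
pose K := (l ^ 2 * k + 2 * l ^ 3 + 2 * l ^ 2 * k.+1 + 2 * l * k)%N.
pose J' := (3 * J * k ^ 2 + 4 * K * A).+1.
have D0 : (0 < 2 * l * k)%N by rewrite !muln_gt0 l0.
have [N HN] := growth J' k (k * A) D0; exists N => n /HN[r [/andP[rn nr] Jr gr2 gr3]].
have r1 : (1 <= r)%N by apply: leq_trans Jr.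
have n1 : (1 <= n)%N by apply: leq_trans rn; rewrite expn_gt0 r1.
have n4 : (n < 4 * r ^ 2)%N.
  by apply: leq_trans nr _; rewrite -(expnMn 2 r 2) leq_exp2r // mul2n -addnn -addn1 leq_add2l.
have kk : (k <= k ^ 2)%N by rewrite -mulnn leq_pmulr.
have J'1 : (3 * J * k <= J')%N.
  by apply: leq_trans (leq_mul (leqnn (3 * J)) kk) _; rewrite /J' -addSn; apply: leq_trans (leqnSn _) (leq_addr _ _).
pose X1 := [set c : {ffun 'I_n -> V} | `[< suboptimal E c (k.+1 * n) >]].
pose X2 := [set c : {ffun 'I_n -> V} | `[< improvable E c r >]].
pose X3 := [set c : {ffun 'I_n -> V} | `[< diluted E c (k * A * r) (2 * l * k) >]].
have cover : (weight E [set c : {ffun 'I_n -> V} | ~~ `[< multipartite_image E l c >]] <=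
    weight E X1 + (weight E X2 + weight E X3))%N.
  rewrite /weight [X in (X <= _)%N]big_mkcond [in X in (_ <= X)%N]big_mkcond.
  rewrite [X in (_ <= _ + (X + _))%N]big_mkcond [X in (_ <= _ + (_ + X))%N]big_mkcond.
  rewrite -!big_split /=; apply: leq_sum => c _; rewrite inE.
  case: asboolP => //= nmulti.
  suff : (c \in X1) || ((c \in X2) || (c \in X3)).
    by case: (c \in X1); case: (c \in X2); case: (c \in X3) => // _;
      rewrite ?add0n ?addn0 // ?leq_addr ?leq_addl.
  (* The lowest scale is [2 * t] for [t = 4 * k.+1 * r], so [2 * t <= theta] at every scale. *)
  have a0 : (0 < 8 * k.+1 * r)%N by rewrite !muln_gt0.
  have [s sk gap] := scale_gap (fun v => #|[set x | c x == v]|) a0 (ltn0Sn k).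
  pose theta := (8 * k.+1 * r * k.+1 ^ s)%N.
  have tA : (theta <= A * r)%N.
    rewrite /theta /A mulnAC leq_mul2r leq_mul2l leq_pexp2l //; lia.
  have th : (8 * k.+1 * r <= theta)%N by rewrite /theta leq_pmulr // expn_gt0.
  have gap' v : (#|[set x | c x == v]| < theta)%N ||
             (k.+1 * theta <= #|[set x | c x == v]|)%N.
    by have := gap v; rewrite expnS mulnCA.
  have [] := dichotomy Eo cle (d := k.+1) (t := (4 * k.+1 * r)%N) (r := r) cQ0 Q0l l0 gap'.
  - by apply: leq_trans th; lia.
  - exact: threshold_slack.
  - by apply: leq_trans th; rewrite ltn_Pmull // (leq_trans _ (leq_pmulr 8 (ltn0Sn k))).
  - rewrite -/k -/K; apply: leq_trans rn; rewrite -mulnn.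
    apply: (@leq_ltn_trans (4 * K * A * r)%N).
      by rewrite -[X in (_ <= X)%N]mulnA leq_mul2l tA orbT.
    by rewrite ltn_mul2r r1 /=; apply: leq_trans Jr; rewrite /J' ltnS leq_addl.
  - by move=> ?; rewrite inE; apply/orP; left; apply/asboolP.
  - by move=> ?; rewrite !inE; apply/or3P; apply: Or32; apply/asboolP.
  - move=> di; rewrite !inE; apply/or3P; apply: Or33; apply/asboolP.
    by apply: dilutedW di; rewrite -mulnA leq_mul2l tA orbT.
  - by move/nmulti.
have w1 := weight_suboptimal E n (k.+1 * n).
have w2 := weight_improvable E n r.
have w3 := weight_diluted E (k * A * r) n1 D0.
rewrite -/k -/X1 -/X2 -/X3 in w1 w2 w3.
set Z := weight E setT in w1 w2 w3 *.
have scaled (a b w : nat) : (0 < b)%N -> (a * w <= b * Z)%N -> (3 * J * b <= a)%N ->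
    (3 * (J * w) <= Z)%N.
  move=> b0 aw ba; rewrite -(leq_pmul2l b0); apply: leq_trans aw.
  rewrite (_ : b * (3 * (J * w)) = (3 * J * b) * w)%N; last by ring.
  by rewrite leq_mul2r ba orbT.
(* In [(2 * 2 ^ k) ^ n] the factor [2 ^ n] pays for [3 * J], and [2 ^ k] beats [k]; hence the slack
   [k.+1] per vertex. *)
have s1 : (3 * (J * weight E X1) <= Z)%N.
  apply: (scaled _ _ _ _ w1); first by rewrite expn_gt0 k0.
  rewrite expnM expnS expnMn; apply: leq_mul.
    apply: leq_trans (ltnW (ltn_expl n (leqnn 2))); apply: leq_trans rn.
    apply: (@leq_trans r); last by rewrite -mulnn leq_pmulr.
    by apply: leq_trans Jr; apply: leq_trans J'1; rewrite leq_pmulr.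
  by rewrite leq_exp2r // ltnW // ltn_expl.
have s2 : (3 * (J * weight E X2) <= Z)%N.
  apply: (scaled _ _ _ _ w2); first by rewrite muln_gt0 n1.
  by apply: leq_trans gr2; rewrite mulnCA mulnC leq_mul2r J'1 orbT.
have s3 : (3 * (J * weight E X3) <= Z)%N.
  apply: (scaled _ _ _ _ w3); first by rewrite muln_gt0 !expn_gt0 muln_gt0 n1 k0.
  by apply: leq_trans gr3; rewrite mulnA leq_mul2r; apply/orP; right; rewrite /J' -addSn;
    apply: leq_trans (leqnSn _) (leq_addr _ _).
rewrite -(@leq_pmul2l 3) // (_ : 3 * Z = Z + (Z + Z))%N; last by ring.
apply: leq_trans (leq_add s1 (leq_add s2 s3)).
by rewrite -!mulnDr !leq_mul2l cover orbT.
Qed.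

Theorem theorem4p11 (V : finType) (E : rel V) (l : nat) :
  oriented E ->
  (0 < #|V|)%N ->
  contains_oriented_complete E l ->
  (forall m : nat, contains_oriented_complete E m -> (m <= l)%N) ->
  aas E (fun n c G => exists (W : {set V}) (F : rel V),
           oriented_blowup_subgraph E l W F /\ image_contained_in c G W F).
Proof.
move=> Eo k0 has_l max_l eps eps0.
have cle (Q : {set V}) : clique (symc E) Q -> (#|Q| <= l)%N.
  by move=> cQ; apply: max_l; apply: contains_clique.
have l0 : (0 < l)%N.
  have [u _] := card_gt0P k0; rewrite -(cards1 u); apply: cle.
  by apply/cliqueP => a b /set1P-> /set1P->; rewrite eqxx.
pose J := (Num.bound eps^-1).
have J_eps : 1 < J%:R * eps.
  rewrite -ltr_pdivrMr // mul1r; apply: archi_boundP; by rewrite invr_ge0 ltW.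
have [N HN] := exceptional_weight J Eo k0 l0 (clique_of_contains has_l) cle.
exists N => n /HN le.
set P := (X in [set cg in _ | X cg]).
set g := #|_|; set D := #|Dcoloured_set E n|.
have DE : D = weight E [set: {ffun 'I_n -> V}].
  rewrite -card_Dcoloured // /D; apply: eq_card => cg; rewrite !inE; by rewrite andbT.
(* A digraph without the property must have an exceptional colouring. *)
have gD : (D <= g + weight E [set c : {ffun 'I_n -> V} | ~~ `[< multipartite_image E l c >]])%N.
  rewrite -card_Dcoloured // /g /D -cardsUI; apply: leq_trans (leq_addr _ _).
  apply: subset_leq_card; apply/subsetP => -[c G]; rewrite !inE /= => DcG.
  rewrite DcG /=; case: (asboolP (multipartite_image E l c)) => [mi|]; last by rewrite orbT.
  by rewrite orbF; apply/asboolP; apply: multipartite_blowup mi.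
have gleD : (g <= D)%N by apply: subset_leq_card; apply/subsetP => cg; rewrite inE => /andP[].
have D0 : (0 < D)%N.
  rewrite DE weightT; have [u _] := card_gt0P k0.
  by rewrite (bigD1 [ffun=> u]) //= addn_gt0 expn_gt0.
have DR : 0 < D%:R :> rat by rewrite ltr0n.
rewrite ger0_norm; last by rewrite subr_ge0 ler_pdivrMr // mul1r ler_nat.
move: le gD; rewrite -DE; set b := weight _ _ => le gD.
have leR : J%:R * b%:R <= D%:R :> rat by rewrite -natrM ler_nat.
have gR : D%:R <= g%:R + b%:R :> rat by rewrite -natrD ler_nat.
have J0 : 0 < J%:R :> rat by rewrite -(pmulr_lgt0 _ eps0); apply: lt_trans J_eps.
have bD : b%:R < eps * D%:R.
  rewrite -(ltr_pM2l J0); apply: le_lt_trans leR _.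
  by rewrite mulrA -[X in X < _]mul1r ltr_pM2r.
rewrite -(ltr_pM2r DR) mulrBl mul1r mulfVK ?gt_eqF //.
by apply: le_lt_trans bD; rewrite lerBlDr addrC.
Qed.
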